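(* Let $(X,\mathcal F,P)$ be a non-atomic probability space, let $\mathcal A\subseteq\mathcal F$ be a sub-$\sigma$-algebra, and let $v_{\mathcal A}$ be the capacity induced by $\mathcal A$. The following are equivalent: 1. for every $F\in\mathcal F$ with $v_{\mathcal A}(F)>0$ there exists $\delta>0$ such that every $G\in\mathcal F$ with $G\subseteq F$ and $P(F\setminus G)<\delta$ satisfies $v_{\mathcal A}(G)>0$; 2. $\lim_n\int_X f_n\,dv_{\mathcal A}=\int_X f\,dv_{\mathcal A}$ for every increasing sequence $\{f_n\}_n\subset\mathcal M$ converging $P$-a.e. to a function $f\in\mathcal M$; 3. $v_{\mathcal A}$ is continuous from below and $P$-null-additive.
   Context: $\mathcal M$ is the collection of all nonnegative $\mathcal F$-measurable functions on $X$. An atom of the probability space is a set $F\in\mathcal F$ with $P(F)>0$ such that every $G\in\mathcal F$ with $G\subseteq F$ has $P(G)=P(F)$ or $P(G)=0$; the space is non-atomic if it has no atoms. The capacity induced by $\mathcal A$ is $v_{\mathcal A}(F)=\max\{P(A): A\in\mathcal A, A\subseteq F\}$, $F\in\mathcal F$ (the maximum is attained; writing $A_F\in\mathcal A$ for a maximizer, $v_{\mathcal A}(F)=P(A_F)$). $\int_X f\,dv_{\mathcal A}$ is the Choquet integral $\int_0^\infty v_{\mathcal A}(\{x: f(x)\ge t\})\,dt\in[0,\infty]$; since $v_{\mathcal A}$ is convex (i.e. $v_{\mathcal A}(F)+v_{\mathcal A}(E)\le v_{\mathcal A}(F\cup E)+v_{\mathcal A}(F\cap E)$), it coincides with the concave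 integral $\sup\{\sum_{i=1}^N\lambda_i v_{\mathcal A}(F_i):\sum_{i=1}^N\lambda_i\mathbf 1_{F_i}\le f, F_i\in\mathcal F,\lambda_i\ge0, N\in\mathbb N\}$. A sequence $\{f_n\}_n$ is increasing if $f_n\le f_{n+1}$ pointwise for all $n$. $v_{\mathcal A}$ is continuous from below if $\lim_n v_{\mathcal A}(F_n)=v_{\mathcal A}(\bigcup_n F_n)$ for every increasing sequence $F_1\subseteq F_2\subseteq\cdots$ in $\mathcal F$. $v_{\mathcal A}$ is $P$-null-additive if $v_{\mathcal A}(G)=v_{\mathcal A}(F)$ for all $G,F\in\mathcal F$ with $G\subseteq F$ and $P(F\setminus G)=0$. *)

(* Defs.v *)
From HB Require Import structures.
From mathcomp Require Import all_boot all_order all_algebra.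
From mathcomp Require Import all_classical all_reals all_analysis.
Import Order.TTheory GRing.Theory Num.Theory.
Import numFieldNormedType.Exports.

Set Implicit Arguments.
Unset Strict Implicit.
Unset Printing Implicit Defensive.

Local Open Scope classical_set_scope.
Local Open Scope ring_scope.
Local Open Scope ereal_scope.

Section Capacity.
Context (d : measure_display) (X : measurableType d) (R : realType).
Implicit Types (P v : set X -> \bar R) (A : set (set X)) (F G : set X).

Definition is_atom P F : Prop :=
  [/\ measurable F, 0 < P F &
    forall G, measurable G -> G `<=` F -> P G = P F \/ P G = 0].

Definition non_atomic P : Prop := forall F, ~ is_atom P F.

Definition sub_salgebra A : Prop :=
  sigma_algebra [set: X] A /\ A `<=` measurable.

(* The supremum is a maximum: see [capacity_attained]. *)
Definition capacity P A F : \bar R :=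
  ereal_sup [set P B | B in [set B | A B /\ B `<=` F]].

(* As [t |-> v [set x | t <= f x]] is nonincreasing for a monotone [v], the
   Lebesgue integral below agrees with the improper Riemann integral. *)
Definition choquet v (f : X -> R) : \bar R :=
  \int[lebesgue_measure]_(t in `[0%R, +oo[) v [set x | (t <= f x)%R].

Definition nonneg_measurable (f : X -> R) : Prop :=
  measurable_fun [set: X] f /\ forall x, (0 <= f x)%R.

Definition continuous_from_below v : Prop :=
  forall F : (set X)^nat, (forall n, measurable (F n)) ->
    (forall n, F n `<=` F n.+1) ->
    v (F n) @[n --> \oo] --> v (\bigcup_n F n).

Definition null_additive P v : Prop :=
  forall F G, measurable F -> measurable G -> G `<=` F ->
    P (F `\` G) = 0 -> v G = v F.

End Capacity.

Lemma capacity_attained (d : measure_display) (X : measurableType d)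
    (R : realType) (P : probability X R) (A : set (set X)) (F : set X) :
  sub_salgebra A ->
  exists B, [/\ A B, B `<=` F & P B = capacity P A F].
Proof.
move=> [[A0 _ Acup] mA].
set S := [set P B | B in [set B | A B /\ B `<=` F]].
have S0 : S != set0.
  by apply/set0P; exists (P set0); exists set0 => //; split.
have [u uS ucvg] := ereal_sup_seq S0.
have /choice[B BP] n : exists B, [/\ A B, B `<=` F & P B = u n].
  by have [B [AB BF] PB] := uS n; exists B.
have AB : A (\bigcup_n B n) by apply: Acup => n; have [] := BP n.
have BF : \bigcup_n B n `<=` F.
  by apply: bigcup_sub => n _; have [] := BP n.
exists (\bigcup_n B n); split=> //; apply/eqP; rewrite eq_le; apply/andP; split.
  by apply: ereal_sup_ubound; exists (\bigcup_n B n).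
rewrite /capacity -/S -(cvg_lim _ ucvg)//; apply: lime_le.
  by apply/cvg_ex; exists (ereal_sup S).
apply: nearW => n; have [ABn _ <-] := BP n.
by apply: le_measure; rewrite ?inE; [exact: mA|exact: mA|exact: bigcup_sup].
Qed.

(* Main.v *)
Require Import Defs.
From mathcomp Require Import all_boot all_order all_algebra.
From mathcomp Require Import all_classical all_reals all_analysis.
From mathcomp Require Import measurable_realfun.
Import Order.TTheory GRing.Theory Num.Theory.
Import numFieldNormedType.Exports.

Set Implicit Arguments.
Unset Strict Implicit.
Unset Printing Implicit Defensive.

Local Open Scope classical_set_scope.
Local Open Scope ring_scope.
Local Open Scope ereal_scope.

(** Write v for the capacity induced by A.  The conditions are linked by the
implications cond1 => cond3, cond3 <=> cond2 and cond3 => cond1.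

cond1 => cond3 ([capacity_ae_continuous]).  Let F_n increase to F up to a
P-null set, and suppose that v (F_n) stays away from v F.  If U is the union of
sets of A that are optimal in the F_n, then P U is at most the limit of
v (F_n), so D = E \ U has positive probability for any E in A that is optimal
in F.  As D is in A, v D > 0; since P (D \ F_n) tends to 0, cond1 gives some n
such that D and F_n have an intersection of positive capacity.  A set of A of
positive probability that lies in F_n and is disjoint from U contradicts the
optimality of the set chosen in F_n.
Continuity from below is the case where F is the union of the F_n, and
null-additivity the case of a constant sequence.

cond3 => cond2 ([choquet_ae_monotone_convergence]).  For a fixed level t the
sets {t <= f_n} increase to a set G t, so monotone convergence for the Lebesgue
integral gives that the Choquet integrals of the f_n tend to the integral of
v (G t).  Up to a null set G t lies between {t < f} and {t <= f}.  Hence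
v (G t) and v {t <= f} are two nonincreasing functions of t that can differ
only at jumps, that is at countably many levels
([countable_monotone_gap]), and they have the same integral.

cond2 => cond3 ([ae_monotone_convergence_continuous_null_additive]).  The
Choquet integral of an indicator is the capacity of the set
([choquet_indic]); so cond2 for indicators of an increasing sequence of sets is
continuity from below, and for a constant sequence of indicators it is
null-additivity.

cond3 => cond1 ([continuous_null_additive_stable]).  If cond1 fails at F, there
are subsets G_n of F of null capacity with P (F \ G_n) < 2 ^ -(n + 1).  By the
Borel-Cantelli lemma the lower limit of the G_n is F up to a null set, whereas
it is an increasing union of sets of null capacity; so v F = 0. *)

(** * Increasing sequences of sets and sub-sigma-algebras *)

Lemma nd_set_seq (T : Type) (F : (set T)^nat) :
  (forall n, F n `<=` F n.+1) ->
  forall m n, (m <= n)%N -> F m `<=` F n.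
Proof.
move=> FS; apply: homo_leq FS; first exact: subset_refl.
by move=> G E H; exact: subset_trans.
Qed.

Section SubSigmaAlgebra.
Context (d : measure_display) (X : measurableType d) (A : set (set X)).
Hypothesis A_sub : sub_salgebra A.

Lemma sub_salgebra_measurable B : A B -> measurable B.
Proof. by case: A_sub => _; apply. Qed.

Lemma sub_salgebra0 : A set0.
Proof. by case: A_sub => -[]. Qed.

Lemma sub_salgebraU B C : A B -> A C -> A (B `|` C).
Proof.
case: A_sub => -[_ _ AU] _ AB AC'; rewrite -bigcup2E; apply: AU => -[|[|n]] //=.
exact: sub_salgebra0.
Qed.

Lemma sub_salgebraD B C : A B -> A C -> A (B `\` C).
Proof.
case: A_sub => -[_ Acompl _] _ AB AC'.
rewrite (_ : _ `\` _ = setT `\` ((setT `\` B) `|` C)).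
  by apply: (Acompl); apply: sub_salgebraU => //; exact: Acompl.
by rewrite !setTD setCU setCK.
Qed.

Lemma sub_salgebra_bigcup (B : (set X)^nat) :
  (forall n, A (B n)) -> A (\bigcup_n B n).
Proof. by case: A_sub => -[_ _ AU] _; exact: AU. Qed.

Lemma sub_salgebra_bigsetU (B : (set X)^nat) n :
  (forall n, A (B n)) -> A (\big[setU/set0]_(i < n) B i).
Proof.
move=> AB; apply: big_ind => //; [exact: sub_salgebra0|exact: sub_salgebraU].
Qed.

End SubSigmaAlgebra.

(** * The induced capacity *)

Section CapacityTheory.
Context (d : measure_display) (X : measurableType d) (R : realType).
Context (P : probability X R) (A : set (set X)).
Hypothesis A_sub : sub_salgebra A.
Implicit Types F G B : set X.

Local Notation v := (capacity P A).

Lemma le_capacity F G : F `<=` G -> v F <= v G.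
Proof.
move=> FG; apply: le_ereal_sup => _ [B [AB BF] <-].
by exists B => //; split=> //; exact: subset_trans FG.
Qed.

Lemma capacity_ubound B F : A B -> B `<=` F -> P B <= v F.
Proof. by move=> AB BF; apply: ereal_sup_ubound; exists B. Qed.

Lemma capacity_ge0 F : 0 <= v F.
Proof.
by rewrite -(measure0 P); apply: capacity_ubound => //; exact: sub_salgebra0.
Qed.

Lemma capacity_fin_num F : v F \is a fin_num.
Proof.
have [B [AB _ <-]] := capacity_attained P F A_sub.
by apply: fin_num_measure; exact: sub_salgebra_measurable AB.
Qed.

Lemma capacity0 : v set0 = 0.
Proof.
have [B [_ + <-]] := capacity_attained P set0 A_sub.
by rewrite subset0 => ->; exact: measure0.
Qed.

End CapacityTheory.

(** * Stability of positivity, continuity and null-additivity *)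

Section Stability.
Context (d : measure_display) (X : measurableType d) (R : realType).
Implicit Types (P v : set X -> \bar R) (F G : set X).

Definition positivity_stable P v : Prop :=
  forall F, measurable F -> 0 < v F ->
    exists delta : R, (0 < delta)%R /\
      forall G, measurable G -> G `<=` F ->
        P (F `\` G) < delta%:E -> 0 < v G.

Definition ae_monotone_convergence (P : probability X R) v : Prop :=
  forall (f_ : nat -> X -> R) (f : X -> R),
    (forall n, nonneg_measurable (f_ n)) -> nonneg_measurable f ->
    (forall n x, (f_ n x <= f_ n.+1 x)%R) ->
    {ae P, forall x, f_ n x @[n --> \oo] --> f x} ->
    choquet v (f_ n) @[n --> \oo] --> choquet v f.

End Stability.

Section StabilityContinuity.
Context (d : measure_display) (X : measurableType d) (R : realType).
Context (P : probability X R) (A : set (set X)).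
Hypothesis A_sub : sub_salgebra A.
Implicit Types F G B : set X.

Local Notation v := (capacity P A).

(** Continuity from below and null-additivity have the same proof; allowing
[F_] to exhaust [F] only up to a null set covers both.  An element of the
sub-sigma-algebra that is optimal in [F] exceeds all those that are optimal in
the [F_ n] by a set [D]; stability of positivity leaves some of [D] in an
[F_ n], where it could be added to an optimal set. *)
Lemma capacity_ae_continuous (F_ : (set X)^nat) F :
  positivity_stable P v ->
  (forall n, measurable (F_ n)) -> measurable F ->
  (forall n, F_ n `<=` F_ n.+1) -> (forall n, F_ n `<=` F) ->
  P (F `\` \bigcup_n F_ n) = 0 ->
  v (F_ n) @[n --> \oo] --> v F.
Proof.
move=> stab mF_ mF F_S F_F PF0.
have F_nd := nd_set_seq F_S.
suff <- : ereal_sup (range (v \o F_)) = v F.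
  by apply: ereal_nondecreasing_cvgn => m n mn; exact/le_capacity/F_nd.
apply/eqP; rewrite eq_le; apply/andP; split.
  by apply: ge_ereal_sup => _ [n _ <-]; exact/le_capacity/F_F.
rewrite leNgt; apply/negP => supF.
have /choice[B BP] n : exists B, [/\ A B, B `<=` F_ n & P B = v (F_ n)].
  exact: capacity_attained.
have AB n : A (B n) by have [] := BP n.
pose U := \bigcup_n B n.
have AU : A U by exact: (sub_salgebra_bigcup A_sub).
have mA := sub_salgebra_measurable A_sub.
(* [B 0], ..., [B n] all lie in [F_ n], so their union competes in the supremum
   [v (F_ n)]. *)
have PU : P U <= ereal_sup (range (v \o F_)).
  rewrite /U -bigcup_bigsetU_bigcup.
  have AUn n : A (\big[setU/set0]_(i < n.+1) B i).
    exact: (sub_salgebra_bigsetU A_sub).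
  have cvgU : P (\big[setU/set0]_(i < n.+1) B i) @[n --> \oo] -->
      P (\bigcup_n \big[setU/set0]_(i < n.+1) B i).
    apply: (@nondecreasing_cvg_mu _ _ _ P
      (fun n => \big[setU/set0]_(i < n.+1) B i)).
    - by move=> n; apply: mA; exact: AUn.
    - by apply: mA; exact: (sub_salgebra_bigcup A_sub).
    - by move=> m n mn; apply/subsetPset; exact: subset_bigsetU.
  rewrite -(cvg_lim _ cvgU)//; apply: lime_le; first exact: cvgP cvgU.
  apply: nearW => n /=.
  apply: (@le_trans _ _ (v (F_ n))); last by apply: ereal_sup_ubound; exists n.
  apply: capacity_ubound; first exact: AUn.
  rewrite -bigcup_mkord => x [i /= ilt Bix].
  by have [_ BF _] := BP i; exact/(F_nd i n)/BF.
have [E [AE EF PE]] := capacity_attained P F A_sub.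
pose D := E `\` U.
have AD : A D by exact: (sub_salgebraD A_sub).
have PD : 0 < P D.
  rewrite lt0e measure_ge0 andbT; apply/eqP => PD0.
  move: supF; rewrite -PE ltNge => /negP; apply; apply: le_trans PU.
  suff : P E <= P U + P D by rewrite PD0 adde0.
  apply: (@le_trans _ _ (P (U `|` D))); last first.
    by apply: measureU2; exact: mA.
  apply: le_measure; rewrite ?inE.
  - exact: mA.
  - by apply: measurableU; exact: mA.
  - by move=> x Ex; have [Ux|nUx] := pselect (U x); [left|right].
have DF : D `<=` F by move=> x [/EF].
have [|delta [delta0 stabD]] := stab D (mA _ AD).
  by apply: lt_le_trans PD _; exact: capacity_ubound.
have mDF n : measurable (D `\` F_ n) by apply: measurableD => //; exact: mA.
have DF_cvg : P (D `\` F_ n) @[n --> \oo] --> 0.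
  have <- : P (\bigcap_n (D `\` F_ n)) = 0.
    apply/eqP; rewrite eq_le measure_ge0 andbT -PF0.
    apply: le_measure; rewrite ?inE.
    - exact: bigcapT_measurable.
    - by apply: measurableD => //; exact: bigcupT_measurable.
    - move=> x DFx; split; first by have [/DF] := DFx 0%N I.
      by move=> [n _ Fnx]; have [] := DFx n I.
  apply: (@nonincreasing_cvg_mu _ _ _ P (fun n => D `\` F_ n)) => //.
  - by rewrite ltey_eq fin_num_measure.
  - exact: bigcapT_measurable.
  - by move=> m n mn; apply/subsetPset => x [Dx nF]; split=> // /(F_nd _ _ mn).
have [n PDn] : exists n, P (D `\` F_ n) < delta%:E.
  apply/not_existsP => H.
  have : delta%:E <= lim (P (D `\` F_ n) @[n --> \oo]).
    apply: lime_ge; first by apply/cvg_ex; exists 0.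
    by apply: nearW => n; rewrite leNgt; exact/negP.
  by rewrite (cvg_lim _ DF_cvg)// lee_fin leNgt delta0.
(* A witness [C] of this positivity is disjoint from [B n], and [C `|` B n]
   beats the optimal [B n] inside [F_ n]. *)
have : 0 < v (D `&` F_ n).
  apply: stabD; [by apply: measurableI => //; exact: mA|by move=> x []|].
  by rewrite setDIr setDv set0U.
have [C [C_A CDF <-]] := capacity_attained P (D `&` F_ n) A_sub.
have [_ BF PB] := BP n.
apply/negP; rewrite -leNgt.
have : P (C `|` B n) <= v (F_ n).
  apply: capacity_ubound; first exact: (sub_salgebraU A_sub).
  by move=> x [/CDF[]|/BF].
have -> : P (C `|` B n) = P C + P (B n).
  apply: measureU; [exact: mA|exact: mA|].
  by rewrite -subset0 => x [/CDF[[_ nU] _] Bx]; apply: nU; exists n.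
by rewrite PB -[leRHS]add0e leeD2rE// capacity_fin_num.
Qed.

Lemma stable_continuous_null_additive :
  positivity_stable P v -> continuous_from_below v /\ null_additive P v.
Proof.
move=> stab; split=> [F_ mF_ F_S|F G mF mG GF PFG].
  apply: capacity_ae_continuous => //.
  - exact: bigcupT_measurable.
  - by move=> n; exact: bigcup_sup.
  - by rewrite setDv measure0.
have := @capacity_ae_continuous (fun=> G) F stab (fun=> mG) mF
  (fun=> @subset_refl _ _) (fun=> GF).
rewrite bigcup_const// => /(_ PFG) GcF.
by rewrite -(cvg_lim _ GcF)// lim_cst.
Qed.

(** If positivity fails to be stable at [F], then sets of null capacity
approximate [F] with summable errors; by Borel-Cantelli their lower limit fills
[F] up to a null set, and continuity and null-additivity force [v F = 0]. *)
Lemma continuous_null_additive_stable :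
  continuous_from_below v -> null_additive P v -> positivity_stable P v.
Proof.
move=> cont nulladd F mF vF; apply: contrapT => H.
have /choice[G GP] n : exists G, [/\ measurable G, G `<=` F,
    P (F `\` G) < ((1 / (2 ^ (n + 1))%:R)%:E : \bar R) & v G = 0].
  apply: contrapT => nG; apply: H.
  exists (1 / (2 ^ (n + 1))%:R)%R; split.
    by rewrite divr_gt0// ltr0n expn_gt0.
  move=> G mG GF PG; rewrite lt0e capacity_ge0// andbT.
  by apply/eqP => vG; apply: nG; exists G.
have mG n : measurable (G n) by have [] := GP n.
(* The [H_ n] increase to the lower limit of the [G n]. *)
pose H_ n := \bigcap_(k in [set k | (n <= k)%N]) G k.
have mH n : measurable (H_ n) by apply: bigcap_measurableType => k _; exact: mG.
have vH n : v (H_ n) = 0.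
  apply/eqP; rewrite eq_le capacity_ge0// andbT.
  have [_ _ _ <-] := GP n; apply: le_capacity.
  by apply: bigcap_inf => /=.
have HS n : H_ n `<=` H_ n.+1.
  by move=> x Hx k /= nk; apply: Hx => /=; exact: ltnW.
have limH := cont H_ mH HS.
have v0 : v (\bigcup_n H_ n) = 0.
  rewrite -(cvg_lim _ limH)//.
  by under eq_fun do rewrite vH; rewrite lim_cst.
move: vF; rewrite -(nulladd F (\bigcup_n H_ n)) ?v0 ?ltxx//.
- exact: bigcupT_measurable.
- by move=> x [n _ Hx]; have [_ GF _ _] := GP n; exact/GF/(Hx n (leqnn n)).
(* The part of [F] outside the lower limit of the [G n] is the upper limit of
   the [F `\` G n]. *)
rewrite (_ : _ `\` _ = lim_sup_set (fun n => F `\` G n)).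
  apply: lim_sup_set_cvg0 => [k|]; first exact: measurableD.
  have h := @cvg_geometric_eseries_half R 1 0.
  apply: (@le_lt_trans _ _ (\sum_(0 <= k <oo) (1 / (2 ^ (k + 1))%:R)%:E)).
    apply: lee_nneseries => // k _.
    by have [_ _ /ltW] := GP k.
  by rewrite (cvg_lim _ h)// ltey.
apply/seteqP; split.
- move=> x [Fx nH] n _; apply: contrapT => nG.
  apply: nH; exists n => // k nk; apply: contrapT => nGx.
  by apply: nG; exists k.
- move=> x L; split; first by have [k _ []] := L 0%N I.
  move=> [n _ Hx]; have [k nk [_ nGx]] := L n I.
  exact/nGx/(Hx k nk).
Qed.

End StabilityContinuity.

(** * The Choquet integral of a monotone set function *)

(** The hypothesis makes the open intervals from [g t] to [h t] pairwise
disjoint, so that picking a rational in each nonempty one is injective. *)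
Lemma countable_monotone_gap (R : realType) (g h : R -> R) :
  (forall s t, (s < t)%R -> (h t <= g s)%R) ->
  countable [set t | (g t < h t)%R].
Proof.
move=> hg; have /choice[q qP] t : exists q : rat,
    (g t < h t)%R -> (g t < ratr q < h t)%R.
  (* Outside the gap set any rational will do. *)
  have [/rat_in_itvoo[q]|_] := ltP (g t) (h t); last by exists 0%R.
  by rewrite in_itv/=; exists q.
apply/countable_injP; exists (choice.pickle \o q) => s t.
rewrite !inE/= => /qP/andP[gs sh] /qP/andP[gt th] /(pcan_inj choice.pickleK) st.
apply/eqP; rewrite eq_le; apply/andP; split; rewrite leNgt; apply/negP => lt_st.
- have := lt_trans (lt_le_trans sh (hg _ _ lt_st)) gt.
  by rewrite st ltxx.
- have := lt_trans (lt_le_trans th (hg _ _ lt_st)) gs.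
  by rewrite st ltxx.
Qed.

Section Choquet.
Context (d : measure_display) (X : measurableType d) (R : realType).
Context (P : probability X R) (v : set X -> \bar R).
Hypothesis v_fin : forall F, v F \is a fin_num.
Hypothesis v_ge0 : forall F, 0 <= v F.
Hypothesis v_mono : forall F G, F `<=` G -> v F <= v G.
Implicit Types F G : set X.

Lemma measurable_nonincreasing_levels (L : R -> set X) (D : set R) :
  measurable D ->
  (forall s t, (s <= t)%R -> L t `<=` L s) ->
  measurable_fun D (fun t => v (L t)).
Proof.
move=> mD L_ni; rewrite (_ : (fun t => _) = EFin \o (fine \o (v \o L))).
  apply/measurable_EFinP; apply: nonincreasing_measurable => // s t st /=.
  by apply: fine_le => //; exact/v_mono/L_ni.
by apply/funext => t /=; rewrite fineK.
Qed.

(** The superlevel set of [\1_F] at [t] is [F] for [0 < t <= 1] and empty for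
[1 < t].  At [t = 0] it is the whole space, which the Lebesgue integral does
not see. *)
Lemma choquet_indic F : v set0 = 0 -> choquet v \1_F = v F.
Proof.
move=> v0; rewrite /choquet -integral_itv_obnd_cbnd; last first.
  apply: measurable_nonincreasing_levels => // s t st x /=.
  exact: le_trans.
transitivity (\int[lebesgue_measure]_(t in `]0%R, +oo[)
    (cst (v F) \_ `]0%R, 1%R]) t).
  apply: eq_integral => t; rewrite inE/= in_itv/= andbT => t0.
  rewrite patchE mem_setE in_itv/= t0/=; case: ifPn => [t1|].
    congr v; apply/seteqP; split => x /=; rewrite indicE; last first.
      by move=> Fx; rewrite mem_set.
    by case: (asboolP (F x)) => // nFx; rewrite memNset// leNgt t0.
  rewrite -ltNge => t1 /=; transitivity (v set0); last by rewrite v0.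
  congr v; rewrite -subset0 => x /=.
  by rewrite indicE leNgt; case: (_ \in _); rewrite ?t1// t0.
rewrite -integral_mkcondr setIidr; last first.
  by move=> t /=; rewrite !in_itv/= andbT => /andP[].
rewrite integral_cst//= lebesgue_measure_itv/= lte_fin ltr01 oppr0 adde0.
by rewrite mule1.
Qed.

(** Null-additivity is stated for nested sets; the intersection with [G]
reduces almost everywhere inclusion to that case. *)
Lemma null_additive_ae_le F G :
  null_additive P v -> measurable F -> measurable G ->
  {ae P, forall x, F x -> G x} -> v F <= v G.
Proof.
move=> nulladd mF mG FG; rewrite -(nulladd F (F `&` G))//.
- by apply: v_mono => x [].
- exact: measurableI.
- rewrite setDIr setDv set0U; apply: measure_negligible.
    exact: measurableD.
  by apply: negligibleS FG => x [Fx nGx] /= FGx; exact/nGx/FGx.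
Qed.

Lemma measurable_superlevel (f : X -> R) t :
  measurable_fun setT f -> measurable [set x | (t <= f x)%R].
Proof.
move=> mf; rewrite -[X in measurable X]setTI.
by apply: measurable_fun_le => //; exact: measurable_cst.
Qed.

(** Apply monotone convergence in [t] to the capacities of the superlevel sets.
The union [G t] of the superlevel sets of the [f_ n] may differ from that of
[f] by more than a null set, but only at countably many levels does this
matter: almost everywhere, [G t] is contained in [{t <= f}] and contains
[{s <= f}] for every [s > t]. *)
Lemma choquet_ae_monotone_convergence :
  continuous_from_below v -> null_additive P v -> ae_monotone_convergence P v.
Proof.
move=> cont nulladd f_ f mf_ [mf f0] f_S f_cvg.
pose E n t : set X := [set x | (t <= f_ n x)%R].
pose G t := \bigcup_n E n t.
have mE n t : measurable (E n t) by apply: measurable_superlevel; case: (mf_ n).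
have ES n t : E n t `<=` E n.+1 t by move=> x /= /le_trans; exact.
have mG t : measurable (G t) by exact: bigcupT_measurable.
have mfx t := measurable_superlevel t mf.
have E_ni n s t : (s <= t)%R -> E n t `<=` E n s.
  by move=> st x; exact: le_trans.
have G_ni s t : (s <= t)%R -> G t `<=` G s.
  by move=> st x [n _ Ex]; exists n => //; exact: E_ni Ex.
have f_ni s t :
    (s <= t)%R -> [set x | (t <= f x)%R] `<=` [set x | (s <= f x)%R].
  by move=> st x; exact: le_trans.
have vGf t : v (G t) <= v [set x | (t <= f x)%R].
  apply: null_additive_ae_le => //.
  apply: filterS f_cvg => x fx [n _ tfn]; apply: (le_trans tfn).
  rewrite -(cvg_lim _ fx)//; apply: nondecreasing_cvgn_le.
  - by apply/nondecreasing_seqP => k; exact: f_S.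
  - by apply/cvg_ex; exists (f x).
have vfG s t : (s < t)%R -> v [set x | (t <= f x)%R] <= v (G s).
  move=> st; apply: null_additive_ae_le => //.
  apply: filterS f_cvg => x fx /= tf.
  have /(cvgr_gt _ fx) : (s < f x)%R by exact: lt_le_trans tf.
  by case=> n _ /(_ n (leqnn n)) sn; exists n => //; exact: ltW.
have -> : choquet v f = \int[lebesgue_measure]_(t in `[0%R, +oo[) v (G t).
  apply: ae_eq_integral => //; try exact: measurable_nonincreasing_levels.
  have gap : countable
      [set t | (fine (v (G t)) < fine (v [set x | (t <= f x)%R]))%R].
    apply: countable_monotone_gap => s t st.
    by apply: fine_le => //; exact: vfG.
  exists [set t | (fine (v (G t)) < fine (v [set x | (t <= f x)%R]))%R].
  split.
  - exact: countable_measurable.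
  - exact: countable_lebesgue_measure0.
  - move=> t /= ne; rewrite ltNge; apply/negP => le_fG; apply: ne => _.
    apply/eqP; rewrite eq_le vGf andbT.
    by rewrite -(fineK (v_fin _)) -[leRHS](fineK (v_fin _)) lee_fin.
rewrite (_ : (fun t => v (G t)) = fun t => limn (fun n => v (E n t))).
  apply: cvg_monotone_convergence => // [n|t _].
  - by apply: measurable_nonincreasing_levels => // s t; exact: E_ni.
  - by move=> m n mn; apply: v_mono; exact: (@nd_set_seq _ (E^~ t)).
by apply/funext => t; apply/esym/cvg_lim => //; exact: cont.
Qed.

(** Both properties are instances of monotone convergence for indicators: of
an increasing sequence of sets, and of the constant sequence [G], which
converges to [F] almost everywhere when [F `\` G] is null. *)
Lemma ae_monotone_convergence_continuous_null_additive :
  v set0 = 0 -> ae_monotone_convergence P v ->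
  continuous_from_below v /\ null_additive P v.
Proof.
move=> v0 mono.
have nneg_indic F : measurable F -> nonneg_measurable (\1_F : X -> R).
  by move=> mF; split=> [|x]; [exact: measurable_indic|rewrite indicE].
have indicS F G x : F `<=` G -> ((\1_F x : R) <= \1_G x)%R.
  move=> FG; rewrite !indicE; have [Fx|nFx] := pselect (F x).
    by rewrite !mem_set//; exact: FG.
  by rewrite (memNset nFx).
split=> [F mF FS|F G mF mG GF PFG].
  suff : choquet v \1_(F n) @[n --> \oo] --> choquet v \1_(\bigcup_n F n).
    by rewrite choquet_indic//; under eq_fun do rewrite choquet_indic//.
  apply: mono => [n||n x|]; [exact: nneg_indic| |exact: indicS|].
    exact/nneg_indic/bigcupT_measurable.
  apply: aeW => x.
  have [[n _ Fx]|nFx] := pselect ((\bigcup_n F n) x).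
    rewrite indicE mem_set; last by exists n.
    apply: cvg_near_cst; exists n => // m /= nm.
    by rewrite indicE mem_set//; exact: (nd_set_seq FS nm).
  rewrite indicE memNset//; under eq_fun => n.
    rewrite indicE memNset; last by move=> Fx; apply: nFx; exists n.
    over.
  exact: cvg_cst.
suff : choquet v \1_G @[_ --> \oo] --> choquet v \1_F.
  rewrite !choquet_indic// => GF_cvg.
  by rewrite -(cvg_lim _ GF_cvg)// lim_cst.
apply: (mono (fun=> \1_G)) => //.
exists (F `\` G); split=> //; first exact: measurableD.
move=> x /= nc; apply: contrapT => FGx; apply: nc.
rewrite (_ : \1_F x = \1_G x); first exact: cvg_cst.
rewrite !indicE; have [Gx|nGx] := pselect (G x).
  by rewrite !mem_set//; exact: GF.
by rewrite !memNset// => Fx; apply: FGx.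
Qed.

End Choquet.

Theorem proposition2 (d : measure_display) (X : measurableType d)
    (R : realType) (P : probability X R) (A : set (set X))
    (P_non_atomic : non_atomic P) (A_sub : sub_salgebra A) :
  let v := capacity P A in
  let cond1 :=
    forall F : set X, measurable F -> 0 < v F ->
      exists delta : R, (0 < delta)%R /\
        forall G : set X, measurable G -> G `<=` F ->
          P (F `\` G) < delta%:E -> 0 < v G in
  let cond2 :=
    forall (f_ : nat -> X -> R) (f : X -> R),
      (forall n, nonneg_measurable (f_ n)) -> nonneg_measurable f ->
      (forall n x, (f_ n x <= f_ n.+1 x)%R) ->
      {ae P, forall x, f_ n x @[n --> \oo] --> f x} ->
      choquet v (f_ n) @[n --> \oo] --> choquet v f in
  let cond3 := continuous_from_below v /\ null_additive P v in
  (cond1 <-> cond2) /\ (cond2 <-> cond3).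
Proof.
move=> v cond1 cond2 cond3.
have v_fin := capacity_fin_num P A_sub.
have v_ge0 := capacity_ge0 P A_sub.
have c13 : cond1 -> cond3 by exact: stable_continuous_null_additive.
have c32 : cond3 -> cond2.
  case=> cont nulladd; apply: choquet_ae_monotone_convergence => //.
  exact: le_capacity.
have c23 : cond2 -> cond3.
  apply: ae_monotone_convergence_continuous_null_additive => //.
  - exact: le_capacity.
  - exact: capacity0.
have c31 : cond3 -> cond1.
  by case=> cont nulladd; exact: continuous_null_additive_stable.
by split; split=> // c; [apply/c32/c13|apply/c31/c23].
Qed.
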